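(* Let $\mathcal N=\{n_i\}_{i=0}^\infty$ be an increasing sequence of integers such that $\lim_{i\to\infty}\frac{n_{i+1}-n_i}{n_{i+2}-n_{i+1}}=0$, and let $\mathcal I(\mathcal N)=\left\{A\subseteq\mathbb N:\lim_{i\to\infty}\frac{|A\cap[n_i,n_{i+1})|}{n_{i+1}-n_i}=0\right\}$. Then $\mathfrak a(\mathcal I(\mathcal N))\leq\mathfrak a$.
   Context: For an ideal $\mathcal I$ on $\mathbb N$, $\mathfrak a(\mathcal I)$ is the least cardinal of a maximal, uncountable, pairwise disjoint family in the quotient Boolean algebra $\mathcal P(\mathbb N)/\mathcal I$; $\mathfrak a=\mathfrak a([\mathbb N]^{<\aleph_0})$, where $[\mathbb N]^{<\aleph_0}$ is the ideal of finite sets. *)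

(* Defs.v *)
From HB Require Import structures.
From mathcomp Require Import all_boot all_order all_algebra finmap.
From mathcomp Require Import all_classical all_reals all_analysis.
From mathcomp Require Import zify.

Set Implicit Arguments.
Unset Strict Implicit.
Unset Printing Implicit Defensive.

Import Order.TTheory GRing.Theory Num.Theory.
Import numFieldNormedType.Exports.

Local Open Scope classical_set_scope.
Local Open Scope ring_scope.

Record ideal := Ideal {
  ideal_mem :> set nat -> Prop;
  ideal0 : ideal_mem set0;
  ideal_sub : forall A B, A `<=` B -> ideal_mem B -> ideal_mem A;
  ideal_setU : forall A B, ideal_mem A -> ideal_mem B -> ideal_mem (A `|` B) }.

Section Congruence.
Variable I : ideal.
Implicit Types A B C D : set nat.

Definition eqmod : rel (set nat) := fun A B => `[< I (A `+` B) >].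

Lemma eqmod_refl : reflexive eqmod.
Proof. by move=> A; apply/asboolP; rewrite setYK; exact: ideal0. Qed.

Lemma eqmod_sym : symmetric eqmod.
Proof. by move=> A B; rewrite /eqmod setYC. Qed.

Lemma eqmod_trans : transitive eqmod.
Proof.
move=> B A C /asboolP AB /asboolP BC; apply/asboolP.
apply: ideal_sub (ideal_setU AB BC) => x; rewrite /setY /=.
by have [?|?] := pselect (B x); tauto.
Qed.

Canonical eqmod_equiv := EquivRel eqmod eqmod_refl eqmod_sym eqmod_trans.

End Congruence.

Definition PN_mod (I : ideal) : Type := {eq_quot (eqmod_equiv I)}%qT.
HB.instance Definition _ (I : ideal) := Choice.on (PN_mod I).
HB.instance Definition _ (I : ideal) := EqQuotient.on (PN_mod I).

Fact PN_mod_display : Order.disp_t. Proof. exact: Order.default_display. Qed.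

Section QuotientAlgebra.
Variable I : ideal.
Implicit Types (A B C D : set nat) (x y z : PN_mod I).

Definition cls A : PN_mod I := \pi_(PN_mod I)%qT A.

Lemma cls_eqP A B : cls A = cls B <-> I (A `+` B).
Proof.
split; first by move/eqquotP/asboolP.
by move=> AB; apply/eqquotP/asboolP.
Qed.

Lemma cls_surj x : exists A, x = cls A.
Proof. by exists (repr x); rewrite /cls reprK. Qed.

Definition qmeet x y := cls (repr x `&` repr y).
Definition qjoin x y := cls (repr x `|` repr y).
Definition qcompl x := cls (~` repr x).
Definition qle x y := qmeet x y == x.
Definition qlt x y := (y != x) && qle x y.

Lemma repr_cls A : I (repr (cls A) `+` A).
Proof. by apply/cls_eqP; rewrite /cls reprK. Qed.

Lemma qmeetE A B : qmeet (cls A) (cls B) = cls (A `&` B).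
Proof.
apply/cls_eqP; apply: ideal_sub (ideal_setU (repr_cls A) (repr_cls B)) => k.
by rewrite /setY /=; have [?|?] := pselect (A k);
  have [?|?] := pselect (repr (cls A) k); tauto.
Qed.

Lemma qjoinE A B : qjoin (cls A) (cls B) = cls (A `|` B).
Proof.
apply/cls_eqP; apply: ideal_sub (ideal_setU (repr_cls A) (repr_cls B)) => k.
by rewrite /setY /=; have [?|?] := pselect (A k);
  have [?|?] := pselect (repr (cls A) k); tauto.
Qed.

Lemma qcomplE A : qcompl (cls A) = cls (~` A).
Proof.
apply/cls_eqP; apply: ideal_sub (repr_cls A) => k.
by rewrite /setY /=; have [?|?] := pselect (A k);
  have [?|?] := pselect (repr (cls A) k); tauto.
Qed.

Let le_def x y : qle x y = (qmeet x y == x). Proof. by []. Qed.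
Let lt_def x y : qlt x y = (y != x) && qle x y. Proof. by []. Qed.

Ltac lift_sets :=
  repeat match goal with x : PN_mod I |- _ => case: (cls_surj x) => ? ->; clear x end;
  rewrite ?(qmeetE, qjoinE).

Let meetC : commutative qmeet.
Proof. by move=> x y; lift_sets; rewrite setIC. Qed.
Let joinC : commutative qjoin.
Proof. by move=> x y; lift_sets; rewrite setUC. Qed.
Let meetA : associative qmeet.
Proof. by move=> x y z; lift_sets; rewrite setIA. Qed.
Let joinA : associative qjoin.
Proof. by move=> x y z; lift_sets; rewrite setUA. Qed.
Let joinKI y x : qmeet x (qjoin x y) = x.
Proof. by lift_sets; rewrite setUC setKU. Qed.
Let meetKU y x : qjoin x (qmeet x y) = x.
Proof. by lift_sets; rewrite setIC setKI. Qed.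
Let meetUl : left_distributive qmeet qjoin.
Proof. by move=> x y z; lift_sets; rewrite setIUl. Qed.
Let meetxx : idempotent_op qmeet.
Proof. by move=> x; lift_sets; rewrite setIid. Qed.

HB.instance Definition _ :=
  Order.isMeetJoinDistrLattice.Build PN_mod_display (PN_mod I)
    le_def lt_def meetC joinC meetA joinA joinKI meetKU meetUl meetxx.

Let le0x x : (cls set0 <= x)%O.
Proof. by apply/eqP; lift_sets; rewrite set0I. Qed.
Let lex1 x : (x <= cls setT)%O.
Proof. by apply/eqP; lift_sets; rewrite setIT. Qed.

HB.instance Definition _ :=
  Order.hasBottom.Build PN_mod_display (PN_mod I) le0x.
HB.instance Definition _ :=
  Order.hasTop.Build PN_mod_display (PN_mod I) lex1.

Let joinxC x : (x `|` qcompl x)%O = \top%O.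
Proof. by lift_sets; rewrite qcomplE [LHS]qjoinE setUv. Qed.
Let meetxC x : (x `&` qcompl x)%O = \bot%O.
Proof. by lift_sets; rewrite qcomplE [LHS]qmeetE setICr. Qed.

HB.instance Definition _ :=
  Order.TBDistrLattice_hasComplement.Build PN_mod_display (PN_mod I)
    joinxC meetxC.

Lemma meet_cls A B : (cls A `&` cls B)%O = cls (A `&` B).
Proof. exact: qmeetE. Qed.
Lemma join_cls A B : (cls A `|` cls B)%O = cls (A `|` B).
Proof. exact: qjoinE. Qed.
Lemma compl_cls A : (~` cls A)%O = cls (~` A).
Proof. exact: qcomplE. Qed.
Lemma bot_cls : \bot%O = cls set0. Proof. by []. Qed.
Lemma top_cls : \top%O = cls setT. Proof. by []. Qed.

Lemma cls_eq0 A : cls A = \bot%O <-> I A.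
Proof.
rewrite bot_cls cls_eqP.
by have -> : A `+` set0 = A by rewrite /setY setD0 set0D setU0.
Qed.

Lemma le_cls A B : (cls A <= cls B)%O <-> I (A `\` B).
Proof.
rewrite leEmeet meet_cls; split=> [/eqP/cls_eqP|IAB].
  by apply: ideal_sub => k; rewrite /setY /=; tauto.
by apply/eqP/cls_eqP; apply: ideal_sub IAB => k; rewrite /setY /=; tauto.
Qed.

End QuotientAlgebra.

Section DisjointFamilies.
Context {d : Order.disp_t} {B : ctbDistrLatticeType d}.
Implicit Types F G : set B.

(* Only nonzero elements are allowed; adjoining 0 would not change
   the cardinality of an uncountable family. *)
Definition disjoint_family F :=
  (forall x, F x -> x <> \bot%O) /\
  (forall x y, F x -> F y -> x <> y -> (x `&` y)%O = \bot%O).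

Definition maximal_disjoint_family F :=
  disjoint_family F /\ forall G, disjoint_family G -> F `<=` G -> G = F.

Definition uncountable_mdf F := maximal_disjoint_family F /\ ~ countable F.

End DisjointFamilies.

(* Cardinals are represented by sets up to equipotence: this says |K| = a(I). *)
Definition card_is_a (I : ideal) {T : Type} (K : set T) :=
  (exists2 F : set (PN_mod I), uncountable_mdf F & (K #= F)%card) /\
  (forall F : set (PN_mod I), uncountable_mdf F -> (K #<= F)%card).

Lemma finite_setU_closed (A B : set nat) :
  finite_set A -> finite_set B -> finite_set (A `|` B).
Proof. by rewrite finite_setU. Qed.

Definition Fin : ideal := {|
  ideal_mem := @finite_set nat;
  ideal0 := finite_set0 nat;
  ideal_sub := @sub_finite_set nat;
  ideal_setU := finite_setU_closed |}.

Section DensityIdeal.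
Variables (R : realType) (n : nat -> int).
Implicit Types A B : set nat.

(* n is integer-valued; A is a set of naturals, so only the natural numbers in
   [n i, n i.+1) matter. *)
Definition block i : set nat := [set k : nat | n i <= k%:Z < n i.+1].

Definition block_density A (i : nat) : R :=
  #|` fset_set (A `&` block i)|%:R / (n i.+1 - n i)%:~R.

Lemma finite_block i : finite_set (block i).
Proof.
apply: (@sub_finite_set _ _ `I_(absz (n i.+1))); last exact: finite_II.
by move=> k; rewrite /block /= => /andP[_]; lia.
Qed.

Lemma finite_setI_block A i : finite_set (A `&` block i).
Proof. by apply: sub_finite_set (finite_block i); exact: subIsetr. Qed.

Lemma block_density_set0 i : block_density set0 i = 0.
Proof. by rewrite /block_density set0I fset_set0 cardfs0 mul0r. Qed.

Lemma block_neg A i : n i.+1 < n i -> A `&` block i = set0.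
Proof. by move=> ni; rewrite -subset0 => k [_]; rewrite /block /=; lia. Qed.

Lemma block_density_ge0 A i : 0 <= block_density A i.
Proof.
have [le_n|/(block_neg A) A0] := leP (n i) (n i.+1).
  by rewrite divr_ge0 // ler0z subr_ge0.
by rewrite /block_density A0 fset_set0 cardfs0 mul0r.
Qed.

Lemma le_block_density A B i : A `<=` B ->
  block_density A i <= block_density B i.
Proof.
move=> AB; have [le_n|/[dup]/(block_neg A) A0 /(block_neg B) B0] := leP (n i) (n i.+1).
  rewrite ler_wpM2r ?invr_ge0 ?ler0z ?subr_ge0// ler_nat fsubset_leq_card//.
  by rewrite -fset_set_sub; [exact: setSI|exact: finite_setI_block..].
by rewrite /block_density A0 B0.
Qed.

Lemma block_density_setU A B i :
  block_density (A `|` B) i <= block_density A i + block_density B i.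
Proof.
have [le_n|ni] := leP (n i) (n i.+1); last first.
  by rewrite /block_density !block_neg// fset_set0 cardfs0 !mul0r addr0.
rewrite -mulrDl ler_wpM2r ?invr_ge0 ?ler0z ?subr_ge0// -natrD ler_nat.
rewrite setIUl fset_setU; try exact: finite_setI_block.
by rewrite cardfsU leq_subr.
Qed.

Definition density_zero A := block_density A i @[i --> \oo] --> (0 : R).

Lemma density_zero0 : density_zero set0.
Proof.
rewrite /density_zero.
by under eq_fun do rewrite block_density_set0; exact: cvg_cst.
Qed.

Lemma density_zero_sub A B : A `<=` B -> density_zero B -> density_zero A.
Proof.
move=> AB dB; apply: (squeeze_cvgr _ (cvg_cst 0) dB).
by near=> i; rewrite block_density_ge0 le_block_density.
Unshelve. all: by end_near. Qed.

Lemma density_zero_setU A B :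
  density_zero A -> density_zero B -> density_zero (A `|` B).
Proof.
move=> dA dB; have dAB : (block_density A i + block_density B i) @[i --> \oo] --> (0 : R).
  by rewrite -[0]addr0; exact: cvgD.
apply: (squeeze_cvgr _ (cvg_cst 0) dAB).
by near=> i; rewrite block_density_ge0 block_density_setU.
Unshelve. all: by end_near. Qed.

(* Being an ideal in the lattice-theoretic sense needs no hypothesis on n. *)
Definition density_ideal : ideal := {|
  ideal_mem := density_zero;
  ideal0 := density_zero0;
  ideal_sub := density_zero_sub;
  ideal_setU := density_zero_setU |}.

End DensityIdeal.

(* Main.v *)
(* For A a set of natural numbers let U(A) be the union of the blocks
   [n_i, n_(i+1)) with i in A.  All but finitely many blocks have density 0 or
   1 in U(A), so U(A) lies in the density ideal iff A is finite, and A |-> U(A)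
   induces an embedding of P(N)/Fin into P(N)/I.  It maps maximal disjoint
   families to maximal disjoint families: if X is not in I, then for some
   e > 0 the set B of the i for which X has density at least e on the i-th
   block is infinite, hence meets some member A of the given family in an
   infinite set, and then X meets U(A) outside I.  The two cardinals exist
   because a nonempty class of sets has a member of least cardinality and
   because the branches of the binary tree form an uncountable almost disjoint
   family. *)
Require Import Defs.
From mathcomp Require Import all_boot all_order all_algebra finmap.
From mathcomp Require Import all_classical all_reals all_analysis.
From mathcomp Require Import zify.

Import Order.TTheory GRing.Theory Num.Theory.
Import numFieldNormedType.Exports.

Local Open Scope classical_set_scope.
Local Open Scope ring_scope.

(* Hoenig's argument: take a maximal set S of choice functions on which the
   evaluation at every member of P is injective; then the evaluation at some
   member of P is onto. *)
Lemma exists_min_card {T : Type} (P : set (set T)) :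
  P !=set0 -> exists2 A, P A & forall B, P B -> (A #<= B)%card.
Proof.
move=> [A0 PA0].
(* [t0] is the default value of choice functions outside [P]. *)
have [[t0]|T0] := pselect ($|T|); last first.
  exists A0 => // B _; suff -> : A0 = set0 by exact: card_ge0.
  by rewrite -subset0 => t; case: T0; exact: squash.
pose ok (S : set (set T -> T)) :=
  (forall g A, S g -> P A -> A (g A)) /\
  (forall g h A, S g -> S h -> P A -> g A = h A -> g = h).
have [|S [[Sin Sinj] Smax]] := @Zorn_bigcup _ ok.
  move=> F Fok Ftot; split=> [g A [X FX Xg]|g h A [X FX Xg] [Y FY Yh]].
    exact: (Fok X FX).1.
  by have [XY|YX] := Ftot _ _ FX FY;
    [apply: (Fok Y FY).2 => //; exact: XY|apply: (Fok X FX).2 => //; exact: YX].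
have [A PA AS] : exists2 A, P A & A `<=` (fun g => g A) @` S.
  apply: contrapT => noA.
  (* Otherwise picking in each member of [P] a value missed by [S] yields a [g] that properly
     extends [S]. *)
  have /choice[g gP] A : exists t, P A -> A t /\ forall h, S h -> h A <> t.
    have [PA|nPA] := pselect (P A); last by exists t0.
    apply: contrapT => not; apply: noA; exists A => // t At.
    apply: contrapT => nt; apply: not; exists t => _; split=> // h Sh hA.
    by apply: nt; exists h.
  apply: (Smax (S `|` [set g])).
    split=> [h Sh|gS]; first by left.
    have Sg : S g by apply: gS; right.
    by have [_ /(_ g Sg)] := gP _ PA0.
  split=> [h A [Sh|->] PA|h k A [Sh|->] [Sk|->] PA // hk].
  - exact: Sin Sh PA.
  - exact: (gP A PA).1.
  - exact: Sinj PA hk.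
  - by have := (gP A PA).2 _ Sh hk.
  - by have := (gP A PA).2 _ Sk (esym hk).
(* Evaluation at [A] maps [S] onto a superset of [A]; evaluation at [B] embeds [S] in [B]. *)
exists A => // B PB; apply: (card_le_trans (subset_card_le AS)).
apply: (card_le_trans (card_image_le _ _)).
have /inj_card_eq SB : {in S &, injective (fun g : set T -> T => g B)}.
  by move=> g h; rewrite !inE => Sg Sh; exact: Sinj.
rewrite -(card_le_eql SB); apply: subset_card_le => _ [g Sg <-].
exact: Sin Sg PB.
Qed.

(** * Maximal disjoint families in a Boolean algebra *)

Section DisjointFamilyLemmas.
Context {d : Order.disp_t} {B : ctbDistrLatticeType d}.
Implicit Types F G : set B.

(** A nonzero element disjoint from every member of [F] could be added to [F]. *)
Lemma maximal_disjoint_familyP F :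
  maximal_disjoint_family F <-> disjoint_family F /\
    forall x : B, x <> \bot%O -> exists2 y, F y & (x `&` y)%O <> \bot%O.
Proof.
split=> -[dF maxF]; split=> //; [move=> x x0|move=> G dG FG].
  apply: contrapT => xF.
  have xF0 y : F y -> (x `&` y)%O = \bot%O.
    by move=> Fy; apply: contrapT => xy; apply: xF; exists y.
  suff dFx : disjoint_family (F `|` [set x]).
    have Fx : F x by rewrite -(maxF _ dFx); [right|left].
    by apply: x0; rewrite -[LHS]meetxx xF0.
  split=> [y [/dF.1//|->//]|y z [Fy|->] [Fz|->] // yz]; first exact: dF.2.
    by rewrite meetC xF0.
  exact: xF0.
rewrite eqEsubset; split=> // x Gx.
have [y Fy xy] := maxF _ (dG.1 _ Gx).
by have [->//|yx] := pselect (x = y); case: xy; apply: dG.2 => //; exact: FG.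
Qed.

Lemma extend_disjoint_family F : disjoint_family F ->
  exists2 G, F `<=` G & maximal_disjoint_family G.
Proof.
move=> dF; have [|A [dA maxA]] := @Zorn_bigcup _ [set G | disjoint_family (F `|` G)].
  move=> C Cd Ctot; split=> [x [/dF.1//|[X CX Xx]]|x y].
    by apply: (Cd X CX).1; right.
  move=> [Fx|[X CX Xx]] [Fy|[Y CY Yy]].
  - exact: dF.2.
  - by apply: (Cd Y CY).2; [left|right].
  - by apply: (Cd X CX).2; [right|left].
  - by have [XY|YX] := Ctot _ _ CX CY;
      [apply: (Cd Y CY).2; right => //; exact: XY|
       apply: (Cd X CX).2; right => //; exact: YX].
exists (F `|` A); first by move=> x; left.
split=> // G dG FAG; apply: contrapT => GFA; apply: (maxA G) => /=; last first.
  rewrite (_ : F `|` G = G)//; apply/setUidPr.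
  by apply: subset_trans FAG => x; left.
split=> [x Ax|GA]; first by apply: FAG; right.
by apply: GFA; rewrite eqEsubset; split=> // x /GA; right.
Qed.

End DisjointFamilyLemmas.

Lemma exists_card_is_a (I : ideal) (F : set (PN_mod I)) :
  uncountable_mdf F -> exists K : set (PN_mod I), card_is_a I K /\ uncountable_mdf K.
Proof.
move=> uF; have [|K uK minK] := exists_min_card (@uncountable_mdf _ (PN_mod I)).
  by exists F.
by exists K; split=> //; split=> //; exists K.
Qed.

(** * An uncountable almost disjoint family of sets of naturals *)

Lemma uncountable_nat_bool : ~ countable [set: nat -> bool].
Proof.
move=> /countable_injP[h hinj].
(* Cantor's diagonal, phrased without an inverse of [h]. *)
pose D k := `[< forall f, h f = k -> ~~ f k >].
have DhD : D (h D) = false.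
  by apply/negP => Dh; have /asboolP/(_ D erefl) := Dh; rewrite Dh.
have /asboolP : ~~ D (h D) by rewrite DhD.
by apply=> f /hinj ->; rewrite ?inE// DhD.
Qed.

Definition branch (f : nat -> bool) : set nat :=
  range (fun m => choice.pickle (mkseq f m)).

Lemma infinite_branch f : infinite_set (branch f).
Proof.
apply/infiniteP; rewrite (card_le_eqr (inj_card_eq _)) ?card_lexx// => m p _ _ /(pcan_inj choice.pickleK) /(congr1 size).
by rewrite !size_mkseq.
Qed.

(** If [f] and [g] differ at [k], their common initial segments have length at most [k]. *)
Lemma branch_almost_disjoint f g : f <> g -> finite_set (branch f `&` branch g).
Proof.
move=> fg; have [k fgk] : exists k, f k <> g k.
  by apply: contrapT => fgE; apply: fg; apply/funext => k; apply: contrapT => ?;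
     apply: fgE; exists k.
apply: (@sub_finite_set _ _ ((fun m => choice.pickle (mkseq f m)) @` `I_k.+1)); last first.
  exact/finite_image/finite_II.
move=> _ [[m _ <-] [p _ /(pcan_inj choice.pickleK) fgE]]; exists m => //=.
have mp : p = m by move/(congr1 size): fgE; rewrite !size_mkseq.
rewrite ltnS leqNgt; apply/negP => km; apply: fgk.
by move/(congr1 (nth false ^~ k)): fgE; rewrite mp !nth_mkseq.
Qed.

Lemma exists_uncountable_mad : exists F : set (PN_mod Fin), uncountable_mdf F.
Proof.
have meet0 f g : f <> g ->
    (cls Fin (branch f) `&` cls Fin (branch g))%O = \bot%O.
  by move=> fg; rewrite meet_cls; apply/cls_eq0; exact: branch_almost_disjoint.
have neq0 f : cls Fin (branch f) <> \bot%O by move=> /cls_eq0/infinite_branch.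
have [|G FG mG] := @extend_disjoint_family _ (PN_mod Fin)
    (range (fun f => cls Fin (branch f))).
  split=> [_ [f _ <-]//|_ _ [f _ <-] [g _ <-] fg].
  by apply: meet0 => fgE; apply: fg; rewrite fgE.
exists G; split=> // /(sub_countable (subset_card_le FG)).
rewrite (eq_countable (inj_card_eq _)); first exact: uncountable_nat_bool.
move=> f g _ _ fg; apply: contrapT => /meet0.
by rewrite fg meetxx; exact: neq0.
Qed.

Lemma finite_set_near (A : set nat) :
  finite_set A <-> \forall i \near \oo, ~ A i.
Proof.
split=> [/finite_seqP[s ->]|[N _ NA]].
  exists (\max_(i <- s) i).+1 => // i /= si si'.
  by have := @leq_bigmax_seq nat s xpredT id i si' isT; rewrite leqNgt si.
apply: (@sub_finite_set _ _ `I_N); last exact: finite_II.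
by move=> i Ai /=; rewrite ltnNge; apply/negP => /NA.
Qed.

(** * The embedding given by unions of blocks *)

Section BlockUnion.
Context {R : realType} {n : nat -> int}.
Hypothesis n_incr : forall i, n i < n i.+1.
Implicit Types A B X : set nat.

Let D := density_ideal R n.

Definition block_union A : set nat := \bigcup_(i in A) block n i.

Lemma block_inj i j k : block n i k -> block n j k -> i = j.
Proof.
have n_homo : {homo n : i j / (i < j)%N >-> i < j}.
  exact: homo_ltn lt_trans n_incr.
have nh p q : (p < q)%N -> n p.+1 <= n q.
  by rewrite leq_eqVlt => /predU1P[->//|/n_homo/ltW].
rewrite /block /= => ki kj; have [/nh|/nh|//] := ltngtP i j; lia.
Qed.

Lemma block_unionI A B : block_union A `&` block_union B = block_union (A `&` B).
Proof.
rewrite eqEsubset; split=> [k [[i Ai ki] [j Bj kj]]|k [i [Ai Bi] ki]].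
  by exists i => //; split=> //; rewrite (block_inj _ _ _ ki kj).
by split; exists i.
Qed.

Lemma block_density_block_union X A i : A i ->
  block_density R n (X `&` block_union A) i = block_density R n X i.
Proof.
move=> Ai; rewrite /block_density -setIA (_ : block_union A `&` block n i = block n i)//.
by apply/setIidPr => k ki; exists i.
Qed.

Lemma block_densityT_near : \forall i \near \oo, block_density R n setT i = 1.
Proof.
have n_ge i : n 0%N + i%:Z <= n i.
  by elim: i => [|i IHi]; [lia|have := n_incr i; lia].
(* From this index on [n i] is nonnegative, so no integer of the block is lost by keeping only
   naturals. *)
exists (absz (n 0%N)) => // i /= n0i.
have ni := n_ge i; have nSi := n_incr i.
have [m m0 nE] : exists2 m, (0 < m)%N & n i.+1 - n i = m%:Z.
  by exists (absz (n i.+1 - n i)); lia.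
rewrite /block_density setTI nE (@card_fset_set _ _ m).
  by rewrite divff// pnatr_eq0 -lt0n.
rewrite (_ : block n i = addn (absz (n i)) @` `I_m).
  by apply: inj_card_eq => p q _ _ /addnI.
rewrite /block eqEsubset; split=> [k /= ki|_ [k /= ki <-]]; last by lia.
by exists (k - absz (n i))%N => /=; lia.
Qed.

Lemma density_zero_block_union A : D (block_union A) <-> finite_set A.
Proof.
rewrite finite_set_near; split=> [/cvgr0_norm_lt/(_ _ ltr01) lt1|nA].
  near=> i => Ai.
  have : `|block_density R n (block_union A) i| < 1 by near: i.
  rewrite -[block_union A]setTI block_density_block_union//.
  by rewrite (near block_densityT_near i)// normr1 ltxx.
apply: cvg_near_cst; near=> i.
rewrite /block_density (_ : _ `&` _ = set0) ?fset_set0 ?cardfs0 ?mul0r//.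
rewrite -subset0 => k [[j Aj kj] ki].
have : ~ A i by near: i.
by apply; rewrite (block_inj _ _ _ ki kj).
Unshelve. all: by end_near. Qed.

Lemma not_density_zero X : ~ D X ->
  exists2 e : R, 0 < e & infinite_set [set i | e <= block_density R n X i].
Proof.
move=> DX; apply: contrapT => noe; apply: DX.
apply/cvgr0Pnorm_lt => e e0; have /finite_set_near : finite_set [set i | e <= block_density R n X i].
  by apply: contrapT => inf; apply: noe; exists e.
apply: filterS => i /negP; rewrite -ltNge ger0_norm//.
exact: block_density_ge0.
Qed.

(** On blocks with index in [A], cutting [X] down to [block_union A] leaves its density
    unchanged. *)
Lemma not_density_zeroI e X A : 0 < e ->
  infinite_set ([set i | e <= block_density R n X i] `&` A) ->
  ~ D (X `&` block_union A).
Proof.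
move=> e0 + /cvgr0_norm_lt/(_ _ e0) XA; apply; apply/finite_set_near.
apply: filterS XA => i /= + [eX Ai]; apply/negP.
by rewrite block_density_block_union// -leNgt ger0_norm// block_density_ge0.
Qed.

Definition cls_block_union (x : PN_mod Fin) : PN_mod D :=
  cls D (block_union (repr x)).

(** The choice of representative is harmless: the symmetric difference of two block unions lies in
    the block union of the symmetric difference of the index sets. *)
Lemma cls_block_unionE A : cls_block_union (cls Fin A) = cls D (block_union A).
Proof.
apply/cls_eqP; have := repr_cls Fin A; set B := repr _ => AB.
apply: ideal_sub ((density_zero_block_union _).2 AB) => k.
case=> -[[i Xi ki] nk]; exists i => //; [left|right]; split=> // Yi.
  by apply: nk; exists i.
by apply: nk; exists i.
Qed.

Lemma cls_block_unionI x y :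
  (cls_block_union x `&` cls_block_union y)%O = cls_block_union (x `&` y)%O.
Proof.
have [A ->] := cls_surj x; have [B ->] := cls_surj y.
by rewrite meet_cls !cls_block_unionE meet_cls block_unionI.
Qed.

Lemma cls_block_union_eq0 x : cls_block_union x = \bot%O <-> x = \bot%O.
Proof.
have [A ->] := cls_surj x.
by rewrite cls_block_unionE !cls_eq0; exact: density_zero_block_union.
Qed.

Lemma maximal_cls_block_union (F : set (PN_mod Fin)) :
  maximal_disjoint_family F -> maximal_disjoint_family (cls_block_union @` F).
Proof.
move=> /maximal_disjoint_familyP[[F0 FI] maxF].
apply/maximal_disjoint_familyP; split; first split.
- by move=> _ [x Fx <-] /cls_block_union_eq0; exact: F0.
- move=> _ _ [x Fx <-] [y Fy <-] xy; rewrite cls_block_unionI.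
  by apply/cls_block_union_eq0/FI => // xyE; apply: xy; rewrite xyE.
move=> z; have [X ->] := cls_surj z => X0.
have /not_density_zero[e e0 infX] : ~ D X by move=> /cls_eq0.
have [|y Fy] := maxF (cls Fin [set i | e <= block_density R n X i]).
  by move=> /cls_eq0.
have [A yA] := cls_surj y; rewrite yA meet_cls => XA0.
exists (cls_block_union y); first by exists y.
rewrite yA cls_block_unionE meet_cls => /cls_eq0; apply: not_density_zeroI e0 _.
by move=> fin; apply: XA0; apply/cls_eq0.
Qed.

(** Distinct members meet in zero, so a common image would equal its meet with itself, hence be
    zero, which only zero maps to. *)
Lemma cls_block_union_inj (F : set (PN_mod Fin)) : disjoint_family F ->
  {in F &, injective cls_block_union}.
Proof.
move=> [F0 FI] x y; rewrite !inE => Fx Fy xy; apply: contrapT => /(FI _ _ Fx Fy).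
move=> /cls_block_union_eq0; rewrite -cls_block_unionI xy meetxx.
by move=> /cls_block_union_eq0/F0.
Qed.

Lemma uncountable_mdf_block_union (F : set (PN_mod Fin)) :
  uncountable_mdf F -> uncountable_mdf (cls_block_union @` F).
Proof.
move=> [mF uF]; split; first exact: maximal_cls_block_union.
by rewrite (eq_countable (inj_card_eq (cls_block_union_inj _ mF.1))).
Qed.

End BlockUnion.

Theorem theorem6p2 (R : realType) (n : nat -> int)
  (n_incr : forall i, n i < n i.+1)
  (n_ratio : ((n i.+1 - n i)%:~R / (n i.+2 - n i.+1)%:~R : R) @[i --> \oo]
               --> (0 : R)) :
  exists (K : set (PN_mod (density_ideal R n))) (L : set (PN_mod Fin)),
    [/\ card_is_a (density_ideal R n) K, card_is_a Fin L & (K #<= L)%card].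
Proof.
have [F0 /exists_card_is_a[L [aL uL]]] := exists_uncountable_mad.
have uUL := uncountable_mdf_block_union (R := R) n_incr _ uL.
have [K [aK _]] := exists_card_is_a _ _ uUL.
exists K, L; split=> //.
(* The image of [L] is one of the families over which [K] is least. *)
exact: card_le_trans (aK.2 _ uUL) (card_image_le _ _).
Qed.
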